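(* Let $k\geq 1$ and $n\geq k+4$ be integers with $n\equiv k \pmod 2$. Let $G$ be a connected graph of order $n$ with matching number at most $\frac{n-k}{2}$. Then the following hold. (i) Suppose $n\leq 3k+6$. If $\rho(G)\geq \rho\left(K_{\frac{n-k}{2}}\vee \frac{n+k}{2}K_{1}\right)$, then $G$ is maximum matching covered unless $G=K_{\frac{n-k}{2}}\vee \frac{n+k}{2}K_{1}$. (ii) Suppose $n\geq 3k+8$. If $\rho(G)\geq \rho\left(K_{2}\vee (K_{n-k-3}\cup (k+1)K_{1})\right)$, then $G$ is maximum matching covered unless $G=K_{2}\vee (K_{n-k-3}\cup (k+1)K_{1})$.
   Context: All graphs are finite, undirected and simple; equality of graphs means isomorphism. The order of a graph is its number of vertices. The spectral radius $\rho(G)$ is the largest eigenvalue of the adjacency matrix of $G$. A matching of $G$ is a set of pairwise disjoint edges; a maximum matching is a matching with the maximum number of edges, and the matching number of $G$ is the size of a maximum matching. $G$ is called maximum matching covered if each edge of $G$ is contained in some maximum matching of $G$. $K_t$ is the complete graph on $t$ vertices; $tG_1$ is the disjoint union of $t$ copies of $G_1$; $G_1\cup G_2$ is the disjoint union of $G_1$ and $G_2$; $G_1\vee G_2$ is the join, i.e. the graph obtained from the disjoint union of $G_1$ and $G_2$ by connecting each vertex of $G_1$ to each vertex of $G_2$. *)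

(* Defs.v *)
From HB Require Import structures.
From mathcomp Require Import all_boot all_order all_algebra.
From mathcomp Require Import spectral complex polyrcf.

Set Implicit Arguments.
Unset Strict Implicit.
Unset Printing Implicit Defensive.

Import Order.TTheory GRing.Theory Num.Theory.

Record sgraph := SGraph {
  vertex :> finType;
  adj : rel vertex;
  adj_sym : symmetric adj;
  adj_irrefl : irreflexive adj }.

Arguments adj {s}.

Definition iso (G H : sgraph) : Prop :=
  exists2 f : G -> H, bijective f & forall x y : G, adj (f x) (f y) = adj x y.

Definition connected_graph (G : sgraph) : Prop :=
  (0 < #|G|)%N /\ forall x y : G, connect adj x y.

Section Complete.
Variable t : nat.
Definition complete_adj : rel 'I_t := fun x y => x != y.
Lemma complete_adj_sym : symmetric complete_adj.
Proof. by move=> x y; rewrite /complete_adj eq_sym. Qed.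
Lemma complete_adj_irrefl : irreflexive complete_adj.
Proof. by move=> x; rewrite /complete_adj eqxx. Qed.
Definition complete : sgraph := SGraph complete_adj_sym complete_adj_irrefl.
End Complete.

Section Copies.
Variables (t : nat) (G : sgraph).
Definition copies_adj : rel ('I_t * G)%type :=
  fun x y => (x.1 == y.1) && adj x.2 y.2.
Lemma copies_adj_sym : symmetric copies_adj.
Proof. by move=> x y; rewrite /copies_adj eq_sym adj_sym. Qed.
Lemma copies_adj_irrefl : irreflexive copies_adj.
Proof. by move=> x; rewrite /copies_adj adj_irrefl andbF. Qed.
Definition copies : sgraph := SGraph copies_adj_sym copies_adj_irrefl.
End Copies.

Section UnionJoin.
Variables G H : sgraph.

Definition union_adj : rel (G + H)%type := fun x y =>
  match x, y with
  | inl a, inl b => adj a b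
  | inr a, inr b => adj a b
  | _, _ => false
  end.
Lemma union_adj_sym : symmetric union_adj.
Proof. by move=> [x|x] [y|y] //=; rewrite adj_sym. Qed.
Lemma union_adj_irrefl : irreflexive union_adj.
Proof. by move=> [x|x] /=; rewrite adj_irrefl. Qed.
Definition union : sgraph := SGraph union_adj_sym union_adj_irrefl.

Definition join_adj : rel (G + H)%type := fun x y =>
  match x, y with
  | inl a, inl b => adj a b
  | inr a, inr b => adj a b
  | _, _ => true
  end.
Lemma join_adj_sym : symmetric join_adj.
Proof. by move=> [x|x] [y|y] //=; rewrite adj_sym. Qed.
Lemma join_adj_irrefl : irreflexive join_adj.
Proof. by move=> [x|x] /=; rewrite adj_irrefl. Qed.
Definition join : sgraph := SGraph join_adj_sym join_adj_irrefl.
End UnionJoin.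

Section Matchings.
Variable G : sgraph.

Definition edges : {set {set G}} :=
  [set e | [exists x : G, exists y : G, adj x y && (e == [set x; y])]].

Definition matching (M : {set {set G}}) : bool :=
  (M \subset edges) && trivIset M.

Definition matching_number : nat :=
  \max_(M : {set {set G}} | matching M) #|M|.

Definition maximum_matching (M : {set {set G}}) : bool :=
  matching M && (#|M| == matching_number).

Definition maximum_matching_covered : Prop :=
  forall e, e \in edges -> exists2 M, maximum_matching M & e \in M.
End Matchings.

(* Imported only here: classical_sets shadows the [set _ | _] notations and
   trivIset of finset used above. *)
From mathcomp Require Import boolp classical_sets reals.

Local Open Scope ring_scope.
Local Open Scope classical_set_scope.

Definition adjmx (R : realType) (G : sgraph) : 'M[R]_#|G| :=
  \matrix_(i, j) (adj (enum_val i) (enum_val j))%:R.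

(* The supremum is attained as soon as G has a vertex: see spectral_radiusP. *)
Definition spectral_radius (R : realType) (G : sgraph) : R :=
  sup [set a : R | eigenvalue (adjmx R G) a].

Lemma symmetric_real_eigenvalue (R : rcfType) (n : nat) (A : 'M[R]_n) :
  (0 < n)%N -> A^T = A -> exists a : R, eigenvalue A a.
Proof.
move=> n_gt0 symA; pose B : 'M[R[i]]_n := map_mx (real_complex R) A.
have [c Bc] := eigenvalue_closed B n_gt0.
suff /complex_realP[a ca] : c \is Num.real.
  by exists a; rewrite -(eigenvalue_map (real_complex R)) /= -[X in eigenvalue _ X]ca.
have /eigenvalueP[v vB v_neq0] := Bc.
pose w : 'cV[R[i]]_n := map_mx Num.conj v^T.
pose q : R[i] := (v *m w) 0 0.
have qE : q = \sum_i `|v 0 i| ^+ 2.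
  by rewrite /q mxE; apply: eq_bigr => i _; rewrite !mxE normCK.
have q_neq0 : q != 0.
  apply: contraNneq v_neq0; rewrite qE => /eqP.
  rewrite psumr_eq0 => [/allP q0|i _]; last by rewrite exprn_ge0.
  apply/eqP/rowP => i; rewrite [RHS]mxE; apply/eqP.
  by have := q0 i (mem_index_enum _); rewrite /= expf_eq0 normr_eq0.
have qC : q^* = q.
  by rewrite qE; apply/CrealP/rpred_sum => i _; rewrite rpredX ?normr_real.
have cq : (v *m B *m w) 0 0 = c * q by rewrite vB -scalemxAl mxE.
have BC : map_mx Num.conj B = B.
  apply/matrixP => i j; rewrite !mxE; apply/CrealP.
  by apply/complex_realP; exists (A i j).
have BT : B^T = B by rewrite /B map_trmx symA.
have cqC : (c * q)^* = c * q.
  have wT : map_mx Num.conj w = v^T by apply/matrixP => i j; rewrite !mxE conjCK.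
  have vw : map_mx Num.conj v = w^T by apply/matrixP => i j; rewrite !mxE.
  rewrite -cq; transitivity ((map_mx Num.conj (v *m B *m w)) 0 0).
    by rewrite [RHS]mxE.
  rewrite !map_mxM BC wT vw -[B in LHS]BT -!trmx_mul mulmxA.
  by rewrite [LHS]mxE.
by apply/CrealP; apply: (mulIf q_neq0); rewrite -{1}qC -rmorphM.
Qed.

Lemma spectral_radiusP (R : realType) (G : sgraph) : (0 < #|G|)%N ->
  eigenvalue (adjmx R G) (spectral_radius R G) /\
  forall a, eigenvalue (adjmx R G) a -> a <= spectral_radius R G.
Proof.
move=> G_gt0; set A := adjmx R G.
have [a0 Aa0] : exists a, eigenvalue A a.
  apply: symmetric_real_eigenvalue G_gt0 _.
  by apply/matrixP => i j; rewrite !mxE adj_sym.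
have p_neq0 : char_poly A != 0 by rewrite monic_neq0 ?char_poly_monic.
have rsP a : eigenvalue A a = (a \in rootsR (char_poly A)).
  by rewrite eigenvalue_root_char -(roots_on_rootsR p_neq0) in_itv.
have max_ex (s : seq R) (x : R) :
    exists2 m, m \in x :: s & forall y, y \in x :: s -> y <= m.
  elim: s x => [|y s IHs] x.
    by exists x => [|y]; rewrite inE // => /eqP->.
  have [m m_in m_ub] := IHs y; have [xm|/ltW mx] := lerP x m.
    by exists m => [|z]; rewrite in_cons ?m_in ?orbT // => /predU1P[->|/m_ub].
  exists x => [|z]; rewrite in_cons ?eqxx // => /predU1P[->//|/m_ub zm].
  exact: le_trans mx.
have [m m_in m_ub] := max_ex (rootsR (char_poly A)) a0.
have Am : eigenvalue A m.
  by move: m_in; rewrite in_cons => /predU1P[->//|]; rewrite -rsP.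
have m_max a : eigenvalue A a -> a <= m.
  by rewrite rsP => a_in; apply: m_ub; rewrite in_cons a_in orbT.
suff -> : spectral_radius R G = m by [].
apply/eqP; rewrite eq_le; apply/andP; split.
  by apply: ge_sup; [exists m | move=> a; apply: m_max].
by apply: ub_le_sup => //; exists m => a; apply: m_max.
Qed.

(* Main.v *)
Require Import Defs.
From mathcomp Require Import all_boot all_order all_algebra.
From mathcomp Require Import reals.
From mathcomp Require Import zify ring lra.
From mathcomp Require boolp.

(** Write n = 2s + k and let G be as in the theorem, not maximum matching
covered, and of spectral radius at least that of the graph H of its case.

Structure. If an edge uv lies in no maximum matching, then deleting u and v
lowers the matching number by at least 2, so G - u - v has deficiency at least
k + 2. The Tutte-Berge formula for G - u - v, with u and v added to its
barrier, gives a set S of t >= 2 vertices such that G - S has at least t + k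
components ([uncovered_barrier]). Only the number of components matters, not
their parity, so it is enough to have the version [tutte_berge] of that formula;
it comes from Gallai's lemma [gallai]. Counting vertices gives t <= s. Hence
grouping components makes G a spanning subgraph of the join of K_t with t + k
disjoint complete graphs. The radius is largest when all but one of these are
single vertices, that is for H(t) = K_t v (K_(2(s-t)+1) u (t+k-1) K_1). The two
extremal graphs are H(s) and H(2).

Spectral bound. A positive function y with A y <= th * y pointwise bounds every
eigenvalue of a connected graph by th, and if th is attained then A y = th * y
everywhere ([collatz_bound]). Take y = 1 on S, and on a block of n vertices the
constant t / (th + 1 - n) that turns the inequality into an equality on a
complete block joined to S. The inequality left, on S, is a bound on a sum of
the terms n / (th + 1 - n); by convexity in n the sum is largest when one block
takes all the excess. If the radius is th, then tightness forces every possible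
adjacency and exactly this distribution of block sizes ([block_radius]), so G
is H(t).

Comparing t. What remains on S is th >= F(t), where F(t) = th defines the
radius of H(t). Clearing denominators, this is [quotient_poly] >= 0. For th the
radius of H(s) (if s <= k + 3) or of H(2) (if s >= k + 4) this polynomial in t
vanishes at the extremal t; the cofactor of that root is monotone up to the
other end of the interval 2 <= t <= s, where its sign is elementary
([star_poly_gt0], [clique_poly_gt0]). So every other t makes th > F(t), which
is incompatible with a radius at least th. *)

Set Implicit Arguments.
Unset Strict Implicit.
Unset Printing Implicit Defensive.

Import Order.TTheory GRing.Theory Num.Theory.

(** * Matchings and barriers *)

Section Barrier.
Variable G : sgraph.
Implicit Types (x y z : G) (W S X U : {set G}) (M N : {set {set G}}).

(** Adjacency in the subgraph induced on U, kept as a relation on all of G so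
that no subtypes are needed. *)
Definition induced U : rel G := [rel x y | [&& x \in U, y \in U & adj x y]].

(** X picks at most one vertex from each component of the subgraph induced on
U, so #|X| is a lower bound for the number of components. *)
Definition pairwise_disconnected U X : Prop :=
  {in X &, forall x y, connect (induced U) x y -> x = y}.

Definition matching_in W M := matching M && (cover M \subset W).

Definition maximum_in W M :=
  matching_in W M && [forall N, matching_in W N ==> (#|N| <= #|M|)].

Lemma edgesP e : reflect (exists x y, adj x y /\ e = [set x; y]) (e \in edges G).
Proof.
rewrite inE; apply: (iffP existsP) => [[x /existsP[y /andP[xy /eqP->]]]|].
  by exists x, y.
by move=> [x [y [xy ->]]]; exists x; apply/existsP; exists y; rewrite xy eqxx.
Qed.

Lemma card_edge e : e \in edges G -> #|e| = 2.
Proof.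
case/edgesP=> x [y [xy ->]]; rewrite cards2.
by case: eqP xy => // ->; rewrite adj_irrefl.
Qed.

Lemma matching_edge M e : matching M -> e \in M -> e \in edges G.
Proof. by case/andP=> /subsetP sub _; apply: sub. Qed.

Lemma card_cover_matching M : matching M -> #|cover M| = (2 * #|M|)%N.
Proof.
move=> mM; case/andP: (mM) => _ /eqP <-.
rewrite (eq_bigr (fun=> 2)) => [|e /(matching_edge mM)/card_edge //].
by rewrite sum_nat_const mulnC.
Qed.

Lemma matching_inj M e f x : matching M -> e \in M -> f \in M ->
  x \in e -> x \in f -> e = f.
Proof.
case/andP=> _ /trivIsetP tM eM fM xe xf; apply/eqP/negPn/negP => /(tM _ _ eM fM).
by move/disjoint_setI0/setP/(_ x); rewrite !inE xe xf.
Qed.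

Lemma matchingP M :
    (forall e, e \in M -> e \in edges G) ->
    (forall e f x, e \in M -> f \in M -> x \in e -> x \in f -> e = f) ->
  matching M.
Proof.
move=> Me Mi; apply/andP; split; first by apply/subsetP.
apply/trivIsetP => e f eM fM ef; rewrite -setI_eq0; apply/eqP/setP => x.
rewrite !inE; apply/negP => /andP[xe xf].
by rewrite (Mi e f x) ?eqxx in ef.
Qed.

Lemma coverP M x : reflect (exists2 e, e \in M & x \in e) (x \in cover M).
Proof. exact: bigcupP. Qed.

Lemma matching_add M x y : matching M -> adj x y ->
    x \notin cover M -> y \notin cover M ->
  [/\ matching ([set x; y] |: M), #|[set x; y] |: M| = #|M|.+1
    & cover ([set x; y] |: M) = [set x; y] :|: cover M].
Proof.
move=> mM xy xM yM.
have out z e : e \in M -> z \in e -> z \notin [set x; y].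
  move=> eM ze; apply/negP; rewrite !inE => /orP[] /eqP zE.
    by case/negP: xM; apply/coverP; exists e; rewrite -?zE.
  by case/negP: yM; apply/coverP; exists e; rewrite -?zE.
have xyM : [set x; y] \notin M.
  by apply/negP => /out/(_ (set21 x y)); rewrite set21.
split.
- apply: matchingP => [e|e f z]; rewrite !in_setU1.
    case/predU1P => [->|/(matching_edge mM)//].
    by apply/edgesP; exists x, y.
  case/predU1P=> [->|eM] /predU1P[->|fM] // ze zf.
  + by case/negP: (out _ _ fM zf).
  + by case/negP: (out _ _ eM ze).
  exact: (matching_inj mM eM fM ze zf).
- by rewrite cardsU1 xyM.
- by rewrite /cover big_setU1.
Qed.

Lemma matching_del M e : matching M -> e \in M ->
  matching (M :\ e) /\ cover (M :\ e) = cover M :\: e.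
Proof.
move=> mM eM; split.
  apply: matchingP => [f|f g x]; rewrite !in_setD1.
    by case/andP=> _ /(matching_edge mM).
  by case/andP=> _ fM /andP[_ gM]; exact: (matching_inj mM fM gM).
apply/setP => x; rewrite in_setD; apply/coverP/andP.
  move=> [f]; rewrite in_setD1 => /andP[fe fM] xf; split; last by apply/coverP; exists f.
  by apply: contra fe => xe; apply/eqP; apply: (matching_inj mM fM eM xf xe).
move=> [xe /coverP[f fM xf]]; exists f => //; rewrite in_setD1 fM andbT.
by apply: contraNneq xe => <-.
Qed.

Lemma maximum_in_exists W : exists M, maximum_in W M.
Proof.
have m0 : matching_in W set0.
  apply/andP; split; last by rewrite /cover big_set0 sub0set.
  by apply: matchingP => [e|e f x]; rewrite inE.
case: (arg_maxnP (fun M => #|M|) m0) => M mM maxM; exists M.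
by rewrite /maximum_in mM; apply/forallP => N; apply/implyP => /maxM.
Qed.

Lemma maximum_in_le W M N : maximum_in W M -> matching_in W N -> #|N| <= #|M|.
Proof. by case/andP=> _ /forallP/(_ N)/implyP. Qed.

Lemma maximum_in_eq W M N : maximum_in W M -> matching_in W N -> #|M| = #|N| ->
  maximum_in W N.
Proof.
move=> maxM mN eqMN; rewrite /maximum_in mN; apply/forallP => L; apply/implyP.
by rewrite -eqMN; apply: maximum_in_le maxM.
Qed.

Lemma maximum_in_adj W M x y : maximum_in W M -> x \in W -> y \in W -> adj x y ->
  (x \in cover M) || (y \in cover M).
Proof.
move=> maxM xW yW xy; apply: contraT; rewrite negb_or => /andP[xM yM].
case/andP: (maxM) => /andP[mM cM] _.
have [mN cN covN] := matching_add mM xy xM yM.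
suff mW : matching_in W ([set x; y] |: M) by have := maximum_in_le maxM mW; rewrite cN ltnn.
by rewrite /matching_in mN covN !subUset cM !sub1set xW yW.
Qed.

(** The exchange argument in Gallai's lemma; t plays the role of a vertex between
x and y. Among the maximum matchings that miss t take an N that shares the most
edges with M. Both cover equally many vertices, and x, y are covered by N only, so
besides t some z is covered by M only. Let zw be its edge in M and f the edge of
N at w: swapping f for zw gives a maximum matching that still misses t and
shares one more edge with M. *)
Lemma gallai_step W M x y t :
    maximum_in W M -> x != y -> x \notin cover M -> y \notin cover M ->
    (forall N, maximum_in W N -> t \notin cover N -> (x \in cover N) && (y \in cover N)) ->
  forall N, maximum_in W N -> t \in cover N.
Proof.
move=> maxM xy xM yM tH N0 maxN0; apply: contraT => tN0.
pose P N := maximum_in W N && (t \notin cover N).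
have PN0 : P N0 by rewrite /P maxN0.
have {maxN0 tN0 PN0} [N /andP[maxN tN] Nmax] := arg_maxnP (fun N => #|M :&: N|) PN0.
have /andP[xN yN] := tH _ maxN tN.
case/andP: (maxM) => /andP[mM cM] _; case/andP: (maxN) => /andP[mN cN] _.
have eqMN : #|M| = #|N|.
  by apply/eqP; rewrite eqn_leq !(maximum_in_le maxM, maximum_in_le maxN) // /matching_in ?mM ?mN.
have eqc : #|cover M| = #|cover N| by rewrite !card_cover_matching ?eqMN.
have [z [zM zN zt]] : exists z, [/\ z \in cover M, z \notin cover N & z != t].
  have le2 : 1 < #|cover M :\: cover N|.
    have -> : #|cover M :\: cover N| = #|cover N :\: cover M|.
      by rewrite !cardsD eqc setIC.
    have <- : #|[set x; y]| = 2 by rewrite cards2 xy.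
    by apply: subset_leq_card; rewrite subUset !sub1set !inE xM yM xN yN.
  have : 0 < #|(cover M :\: cover N) :\ t|.
    by move: le2; rewrite (cardsD1 t); case: (t \in _) => //; apply: ltnW.
  by case/card_gt0P=> z; rewrite !inE => /and3P[zt zN zM]; exists z.
have /coverP[e eM ze] := zM.
have [w [zw eE]] : exists w, adj z w /\ e = [set z; w].
  have /edgesP[a [b [ab eE]]] := matching_edge mM eM.
  move: ze; rewrite eE !inE => /orP[]/eqP->; first by exists b.
  by exists a; rewrite adj_sym setUC.
have wM : w \in cover M by apply/coverP; exists e; rewrite // eE !inE eqxx orbT.
have wN : w \in cover N.
  by have := maximum_in_adj maxN (subsetP cM _ zM) (subsetP cM _ wM) zw; rewrite (negPf zN).
have /coverP[f fN wf] := wN.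
have [mD cD] := matching_del mN fN.
have zD : z \notin cover (N :\ f) by rewrite cD !inE (negPf zN) andbF.
have wD : w \notin cover (N :\ f) by rewrite cD !inE wf.
have [mN' cardN' cN'] := matching_add mD zw zD wD.
have eN : e \notin N by apply: contra zN => eN; apply/coverP; exists e.
have fM : f \notin M.
  apply/negP => fM; case/negP: eN.
  by rewrite (matching_inj mM eM fM (x := w)) // eE !inE eqxx orbT.
have PN' : P ([set z; w] |: (N :\ f)).
  apply/andP; split.
    apply: (maximum_in_eq maxN); last by rewrite cardN' (cardsD1 f N) fN.
    rewrite /matching_in mN' cN' cD !subUset !sub1set !(subsetP cM) //=.
    by apply: subset_trans cN; apply: subsetDl.
  rewrite cN' cD !inE (negPf tN) andbF orbF negb_or eq_sym zt /=.
  by apply: contraNneq tN => ->.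
have := Nmax _ PN'; rewrite /geq /= leqNgt => /negP[]; apply: proper_card; apply/properP; split.
  apply/subsetP => g; rewrite !in_setI !in_setU1 in_setD1 => /andP[gM gN].
  rewrite gM gN andbT orbC; case: eqP => //= gf; by rewrite -gf gM in fM.
by exists e; rewrite in_setI eM ?(negPf eN) // -eE setU11.
Qed.

(** Gallai's lemma. Induction along a walk from x to y: if t is its second
vertex, then x, t cannot both be missed because they are adjacent, nor t, y by
induction, so [gallai_step] applies to any M that misses x and y. *)
Lemma gallai W :
    (forall v, v \in W -> exists2 M, maximum_in W M & v \notin cover M) ->
  forall M, maximum_in W M -> pairwise_disconnected W (W :\: cover M).
Proof.
move=> miss M maxM x y; rewrite !in_setD => /andP[xM xW] /andP[yM yW] /connectP[p].
move: p x M maxM xM xW yM => p; elim: p => [|t p IHp] /= x M maxM xM xW yM; first by move=> _ ->.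
move=> /andP[/and3P[_ tW xt] tp yE]; have [//|xy] := eqVneq x y.
have := maximum_in_adj maxM xW.
have [ty|ty] := eqVneq t y.
  by move/(_ _ tW xt); rewrite ty (negPf xM) (negPf yM).
have [N maxN tN] := miss _ tW.
have := @gallai_step W M x y t maxM xy xM yM _ N maxN; rewrite (negPf tN) => H _.
suff : false by [].
apply: H => L maxL tL.
have := maximum_in_adj maxL xW tW xt; rewrite (negPf tL) orbF => -> /=.
apply: contraT => yL; case/eqP: ty; exact: (IHp t L maxL tL tW yL tp yE).
Qed.

(** The existence half of the Tutte-Berge formula, with the components of
G[W \ S] represented by a set X and without parity. A vertex of W that is in
every maximum matching goes into S, and its deletion lowers the matching number.
If there is no such vertex, S is empty and Gallai's lemma makes the missed
vertices lie in different components. *)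
Lemma tutte_berge W : exists M S X,
  [/\ matching_in W M, S \subset W, X \subset W :\: S, pairwise_disconnected (W :\: S) X
    & #|S| + #|W| <= #|X| + 2 * #|M|].
Proof.
have [n] := ubnP #|W|; elim: n => // n IHn in W *; rewrite ltnS => leWn.
have [M maxM] := maximum_in_exists W; have /andP[mM _] := maxM.
have [/existsP[v /andP[vW /forallP vall]]|] :=
    boolP [exists v, (v \in W) && [forall N, maximum_in W N ==> (v \in cover N)]].
  have cW := cardsD1 v W; rewrite vW in cW.
  have [|N [S [X [mN SW XS dX le]]]] := IHn (W :\ v); first by lia.
  exists M, (v |: S), X.
  have eqD : W :\: (v |: S) = (W :\ v) :\: S by rewrite setDDl.
  have vS : v \notin S by apply/negP => /(subsetP SW); rewrite !inE eqxx.
  have ltNM : #|N| < #|M|.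
    have /andP[mN1 cN] := mN.
    have mNW : matching_in W N.
      by rewrite /matching_in mN1; apply: subset_trans cN (subsetDl _ _).
    rewrite ltn_neqAle (maximum_in_le maxM mNW) andbT; apply/eqP => eqNM.
    have /implyP := vall N; rewrite (maximum_in_eq maxM mNW) // => /(_ isT).
    by move/(subsetP cN); rewrite !inE eqxx.
  split; rewrite ?eqD //; last by rewrite cardsU1 vS; lia.
  by rewrite subUset sub1set vW (subset_trans SW (subsetDl _ _)).
rewrite negb_exists => /forallP all_miss.
exists M, set0, (W :\: cover M); rewrite setD0; split => //.
- exact: sub0set.
- exact: subsetDl.
- apply: gallai maxM => v vW; have := all_miss v; rewrite vW negb_forall => /existsP[N].
  by rewrite negb_imply => /andP[]; exists N.
have /andP[mM1 cM] := mM.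
by rewrite cards0 cardsD (setIidPr cM) -(card_cover_matching mM1); lia.
Qed.

Lemma matching_number_ge M : matching M -> #|M| <= matching_number G.
Proof. by move=> mM; apply: (@leq_bigmax_cond _ (@matching G) (fun N => #|N|)). Qed.

(** The barrier contains both ends of an edge that is in no maximum matching;
this is what gives 1 < #|S| and so excludes the graphs H(0) and H(1), which may
have a larger radius. *)
Lemma uncovered_barrier k :
    2 * matching_number G + k <= #|G| ->
    ~ maximum_matching_covered G ->
  exists S X, [/\ 1 < #|S|, #|X| = #|S| + k, X \subset ~: S & pairwise_disconnected (~: S) X].
Proof.
move=> nuG ncov.
have [e /andP[eG /forallP eM]|all_cov] :=
    @pickP _ (fun e => (e \in edges G) && [forall M, maximum_matching M ==> (e \notin M)]).
  2:{ case: ncov => e eG; have := all_cov e; rewrite eG /= => /negbT; rewrite negb_forall.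
      by case/existsP=> M; rewrite negb_imply negbK => /andP[]; exists M. }
have [u [v [uv eE]]] := edgesP _ eG.
have neq_uv : u != v by apply: contraTneq uv => ->; rewrite adj_irrefl.
have [M [S [X [/andP[mM cM] SW XW dX le]]]] := tutte_berge (~: [set u; v]).
have out x : x \in [set u; v] -> x \notin cover M.
  by move=> xuv; apply/negP => /(subsetP cM); rewrite in_setC xuv.
have [mM' cardM' _] := matching_add mM uv (out _ (set21 _ _)) (out _ (set22 _ _)).
have ltM : #|M| + 2 <= matching_number G.
  have leM : #|M|.+1 <= matching_number G.
    by rewrite -cardM' matching_number_ge.
  have neM : #|M|.+1 != matching_number G.
    apply/negP => eqM; have /implyP := eM ([set u; v] |: M).
    rewrite /maximum_matching mM' cardM' eqM eE => /(_ isT).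
    by rewrite setU11.
  by rewrite addn2 ltn_neqAle neM.
have cW : #|~: [set u; v]| = #|G| - 2 by rewrite cardsCs setCK cards2 neq_uv.
have cG : 2 <= #|G| by have := max_card [set u; v]; rewrite cards2 neq_uv.
have uS x : x \in [set u; v] -> x \notin S.
  by move=> xuv; apply/negP => /(subsetP SW); rewrite in_setC xuv.
pose S' := [set u; v] :|: S.
have cS' : #|S'| = #|S| + 2.
  rewrite /S' cardsU cards2 neq_uv.
  have -> : [set u; v] :&: S = set0.
    by apply/eqP; rewrite setI_eq0 disjoint_subset; apply/subsetP => x /uS.
  by rewrite cards0; lia.
have S'W : ~: S' = ~: [set u; v] :\: S by rewrite setDE /S' setCU.
have leX : #|S'| + k <= #|X| by lia.
have [Y [YX cY]] : exists Y : {set G}, Y \subset X /\ #|Y| = #|S'| + k.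
  (* The choice of exactly #|S'| + k blocks fixes the size of the large block. *)
  have /card_geqP[s [us ss sX]] := leX.
  exists [set x in s]; split; first by apply/subsetP => x; rewrite inE => /sX.
  by rewrite -ss -(card_uniqP us); apply: eq_card => x; rewrite inE.
exists S', Y; split => //; first by rewrite cS'; lia.
  by rewrite S'W; apply: subset_trans YX XW.
by rewrite S'W => x y /(subsetP YX) xX /(subsetP YX) yX; apply: dX.
Qed.
End Barrier.

(** Every component that meets X is a block of its own, except that all the
components that avoid X are merged into the block of one fixed vertex x0 of X:
this gives exactly #|X| blocks. *)
Lemma disconnected_blocks (G : sgraph) (S X : {set G}) :
    (0 < #|X|)%N -> X \subset ~: S -> pairwise_disconnected (~: S) X ->
  exists2 l : G -> G,
    forall x y, x \notin S -> y \notin S -> adj x y -> l x = l y &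
    #|l @: ~: S| = #|X|.
Proof.
case/card_gt0P=> x0 x0X XS dX.
pose e := induced (~: S).
have e_sym : connect_sym e.
  by apply: sym_connect_sym => x y; rewrite /e /induced /= adj_sym andbCA.
pose l x := odflt x0 [pick z in X | connect e x z].
have lX x : l x \in X by rewrite /l; case: pickP => //= z /andP[].
have l_id x : x \in X -> l x = x.
  rewrite /l => xX; case: pickP => [z /andP[zX xz]|/(_ x)]; first by rewrite (dX x z).
  by rewrite xX connect0.
exists l.
  move=> x y xS yS xy; rewrite /l (eq_pick (Q := fun z => (z \in X) && connect e y z)) //.
  move=> z; congr (_ && _); apply: (same_connect e_sym).
  by apply: connect1; rewrite /e /induced /= !in_setC xS yS.
suff -> : l @: (~: S) = X by [].
apply/eqP; rewrite eqEsubset; apply/andP; split; apply/subsetP => x.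
  by case/imsetP => z _ ->.
by move=> xX; apply/imsetP; exists x; rewrite ?l_id ?(subsetP XS).
Qed.

(** * Eigenvalues and positive test functions *)

Section Spectral.
Local Open Scope ring_scope.
Variables (R : realType) (G : sgraph).
Implicit Types (y v : G -> R) (a th : R).

Lemma eigenvalue_adjP a :
  eigenvalue (adjmx R G) a <->
  exists v, (exists x, v x != 0) /\ forall x, \sum_(z | adj x z) v z = a * v x.
Proof.
have sumE (v : G -> R) (x : G) :
    \sum_(i < #|G|) v (enum_val i) * adjmx R G i (enum_rank x) = \sum_(z | adj x z) v z.
  rewrite [RHS]big_mkcond /= (big_enum_val (fun z => if adj x z then v z else 0)) /=.
  by apply: eq_bigr => i _; rewrite !mxE enum_rankK adj_sym; case: ifP; rewrite ?mulr1 ?mulr0.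
split.
  move=> /eigenvalueP[u uA u0].
  exists (fun x => u 0 (enum_rank x)); split.
    have [i ui] : exists i, u 0 i != 0.
      apply/existsP; apply: contraR u0; rewrite negb_exists => /forallP u0.
      by apply/eqP/rowP => i; rewrite [RHS]mxE; apply/eqP/negPn/u0.
    by exists (enum_val i); rewrite enum_valK.
  move=> x; move/rowP: uA => /(_ (enum_rank x)); rewrite [RHS]mxE => <-.
  rewrite -sumE mxE; apply: eq_bigr => i _; by rewrite enum_valK.
case=> v [[x vx] vA]; apply/eigenvalueP; exists (\row_i v (enum_val i)).
  apply/rowP => j; rewrite !mxE -vA -[in LHS](enum_valK j) -sumE.
  by apply: eq_bigr => i _; rewrite mxE.
by apply: contraNneq vx => /rowP/(_ (enum_rank x)); rewrite !mxE enum_rankK => ->.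
Qed.

(** Compare an eigenfunction v with y at a vertex where |v| / y is maximal. When
a = th, all inequalities at such a vertex are equalities, so its neighbours
maximise |v| / y too, and by connectedness all vertices do. *)
Lemma collatz_bound y th a : connected_graph G -> (forall x, 0 < y x) ->
    (forall x, \sum_(z | adj x z) y z <= th * y x) ->
    eigenvalue (adjmx R G) a ->
  a <= th /\ (a = th -> forall x, \sum_(z | adj x z) y z = th * y x).
Proof.
move=> [_ Gconn] y0 yA /eigenvalue_adjP[v [[x0 vx0] vA]].
have [i _ imax] := @arg_maxP _ R G x0 xpredT (fun x => `|v x| / y x) isT.
set m := `|v i| / y i in imax.
have m_gt0 : 0 < m.
  by apply: lt_le_trans (imax x0 isT); rewrite divr_gt0 ?normr_gt0.
have le_m x : `|v x| <= m * y x by rewrite -ler_pdivrMr //; apply: imax.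
have chain x : a * `|v x| <= \sum_(z | adj x z) `|v z|.
  apply: le_trans (ler_norm_sum _ _ _); rewrite vA normrM.
  by rewrite ler_wpM2r // ler_norm.
have sum_le x : \sum_(z | adj x z) `|v z| <= m * \sum_(z | adj x z) y z.
  rewrite mulr_sumr; apply: ler_sum => z _; exact: le_m.
have mth x : m * \sum_(z | adj x z) y z <= m * (th * y x).
  by apply: ler_wpM2l; [exact: ltW | exact: yA].
have vi : `|v i| = m * y i by rewrite /m divfK // gt_eqF.
have vi0 : 0 < `|v i| by rewrite vi mulr_gt0.
split.
  rewrite -(ler_pM2r vi0); apply: le_trans (chain i) _; apply: le_trans (sum_le i) _.
  by rewrite vi mulrCA.
move=> ath.
have tight x : `|v x| = m * y x ->
    \sum_(z | adj x z) y z = th * y x /\ forall z, adj x z -> `|v z| = m * y z.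
  move=> vx.
  have eq1 : m * (th * y x) = \sum_(z | adj x z) `|v z|.
    apply/eqP; rewrite eq_le (le_trans (sum_le x) (mth x)) andbT.
    by rewrite mulrCA -vx -ath.
  have eq2 : m * \sum_(z | adj x z) y z = m * (th * y x).
    by apply/eqP; rewrite eq_le mth eq1 sum_le.
  split; first by apply: (mulfI (lt0r_neq0 m_gt0)).
  move=> z xz; apply/eqP; rewrite eq_sym -subr_eq0.
  have : \sum_(z | adj x z) (m * y z - `|v z|) == 0.
    by rewrite sumrB -mulr_sumr eq2 eq1 subrr.
  rewrite psumr_eq0 => [/allP/(_ z (mem_index_enum _))|w _]; last by rewrite subr_ge0.
  by rewrite xz.
move=> x; suff /tight[] : `|v x| = m * y x by [].
have /connectP[p + ->] := Gconn i x.
elim/last_ind: p => [//|p z IHp]; rewrite rcons_path last_rcons => /andP[/IHp/tight[_ +]].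
exact.
Qed.

End Spectral.

(** * The extremal graphs *)

Section Labels.
Implicit Types G H : sgraph.

(** The extremal graphs K_t v (K_m u p K_1) have three kinds of vertices: 0 for
the vertices joined to everything, 1 for those of the clique K_m, 2 for the
isolated ones. Adjacency of distinct vertices depends on their labels only. *)
Definition label_rel : rel 'I_3 := fun i j =>
  [|| i == 0%N :> nat, j == 0%N :> nat | (i == 1%N :> nat) && (j == 1%N :> nat)].

(** G is K_t v (K_m u p K_1), with l as the labelling; m = 0 is allowed and
gives K_t v p K_1. *)
Definition extremal_label G (t m p : nat) (l : G -> 'I_3) : Prop :=
  (forall x y, adj x y = (x != y) && label_rel (l x) (l y)) /\
  [/\ #|[set x | l x == 0%N :> nat]| = t, #|[set x | l x == 1%N :> nat]| = m
    & #|[set x | l x == 2%N :> nat]| = p].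

(** Send the i-th vertex of each label class of G to the i-th vertex of the same
class of H. *)
Lemma extremal_label_iso G H t m p (lG : G -> 'I_3) (lH : H -> 'I_3) :
  extremal_label t m p lG -> extremal_label t m p lH -> iso G H.
Proof.
move=> [adjG [G0 G1 G2]] [adjH [H0 H1 H2]].
pose cG i := enum [set x | lG x == i]; pose cH i := enum [set x | lH x == i].
have size_eq i : size (cG i) = size (cH i).
  rewrite /cG /cH -!cardE; case: i => [[|[|[|//]]] i3].
  - exact: etrans G0 (esym H0).
  - exact: etrans G1 (esym H1).
  - exact: etrans G2 (esym H2).
have lt_ix x : (index x (cG (lG x)) < size (cH (lG x)))%N.
  by rewrite -size_eq index_mem mem_enum inE.
(* A default vertex for nth, available because the class of x in H is nonempty. *)
have def (x : G) : H.
  move: (lt_ix x); case: (cH (lG x)) => [|h _ _]; [by rewrite ltn0 | exact: h].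
pose f x := nth (def x) (cH (lG x)) (index x (cG (lG x))).
have f_in x : f x \in cH (lG x) by rewrite mem_nth.
have lf x : lH (f x) = lG x by have := f_in x; rewrite mem_enum inE => /eqP.
have f_inj : injective f.
  move=> x y fxy; have lxy : lG x = lG y by rewrite -!lf fxy.
  move: fxy; rewrite /f (set_nth_default (def x) (def y)) ?lt_ix // lxy.
  move/eqP; rewrite nth_uniq ?enum_uniq ?lt_ix //; last by rewrite -lxy lt_ix.
  move/eqP/(congr1 (nth x (cG (lG y)))).
  by rewrite !nth_index // mem_enum inE ?lxy.
have cardGH : #|G| = #|H|.
  have sum_card (K : sgraph) (l : K -> 'I_3) :
      #|K| = (\sum_(i < 3) #|[set x | l x == i]|)%N.
    rewrite -sum1_card (partition_big l predT) //=; apply: eq_bigr => i _.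
    by rewrite -sum1_card; apply: eq_bigl => x; rewrite inE.
  rewrite (sum_card G lG) (sum_card H lH); apply: eq_bigr => i _.
  by have := size_eq i; rewrite /cG /cH -!cardE.
exists f; first by apply: inj_card_bij; rewrite ?cardGH.
by move=> x y; rewrite adjG adjH !lf (inj_eq f_inj).
Qed.

(** The eigenvalue equations on functions constant on label classes, with values
1, b, c. *)
Lemma extremal_label_eigen (R : realType) G t m p (l : G -> 'I_3) (th b c : R) :
    extremal_label t m p l -> (0 < t)%N ->
    (th = t%:R - 1 + m%:R * b + p%:R * c)%R ->
    (th * b = t%:R + (m%:R - 1) * b)%R -> (th * c = t%:R)%R ->
  eigenvalue (adjmx R G) th.
Proof.
move=> [adjG [G0 G1 G2]] t_gt0 eq0 eq1 eq2; apply/eigenvalue_adjP.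
pose w (i : 'I_3) : R := (if i == 0%N :> nat then 1 else if i == 1%N :> nat then b else c)%R.
exists (fun x => w (l x)); split.
  rewrite -G0 in t_gt0; have /card_gt0P[x] := t_gt0; rewrite inE => x0.
  by exists x; rewrite /w x0 oner_eq0.
move=> x.
have split_sum (P : pred 'I_3) : (\sum_(z | P (l z)) w (l z) =
    (P ord0)%:R * t%:R + (P (inord 1))%:R * m%:R * b + (P (inord 2))%:R * p%:R * c)%R.
  have cls (i : 'I_3) : (\sum_(z | P (l z) && (l z == i)) w (l z) =
    (P i)%:R * #|[set x | l x == i :> nat]|%:R * w i)%R.
    rewrite (eq_bigl (fun z => (z \in [set x | l x == i :> nat]) && P i)); last first.
      move=> z; rewrite inE; rewrite -(inj_eq val_inj) /= andbC; case: eqP => //= e.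
      by congr P; apply: val_inj.
    case: (P i) => /=; last by rewrite big_pred0 ?mul0r // => z; rewrite andbF.
    rewrite mul1r (eq_bigl (fun z => z \in [set x | l x == i :> nat])); last first.
      by move=> z; rewrite andbT.
    rewrite (eq_bigr (fun=> w i)); last first.
      by move=> z; rewrite inE => /eqP/val_inj ->.
    by rewrite sumr_const mulr_natl.
  rewrite (partition_big l predT) //= !big_ord_recl big_ord0 addr0 !cls /=.
  rewrite G0 /w /= mulr1 addrA; congr (_ + _ + _)%R.
    by rewrite -G1; congr (_ * _ * _)%R; congr ((P _)%:R)%R; apply: val_inj; rewrite /= inordK.
  by rewrite -G2; congr (_ * _ * _)%R; congr ((P _)%:R)%R; apply: val_inj; rewrite /= inordK.
have -> : (\sum_(z | adj x z) w (l z) =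
    \sum_(z | label_rel (l x) (l z)) w (l z) - (label_rel (l x) (l x))%:R * w (l x))%R.
  case: (boolP (label_rel (l x) (l x))) => rxx.
    rewrite [in RHS](bigD1 x) //= mul1r [RHS]addrC addKr.
    by apply: eq_bigl => z; rewrite adjG andbC eq_sym.
  rewrite mul0r subr0; apply: eq_bigl => z; rewrite adjG.
  by case: eqP => //= <-; rewrite (negPf rxx).
rewrite split_sum /label_rel !inordK //= /w.
case: (l x) => [[|[|[|//]]] i3] /=; rewrite ?(mul0r, mul1r, mulr1, addr0, subr0, add0r).
- rewrite [RHS]eq0; ring.
- by rewrite eq1; ring.
- by rewrite eq2.
Qed.

Lemma extremal_label_radius (R : realType) H t m p (l : H -> 'I_3) (th : R) :
    extremal_label t m p l -> (0 < t)%N -> (0 < th + 1 - m%:R)%R -> (0 < th)%R ->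
    (th = t%:R - 1 + t%:R * (m%:R / (th + 1 - m%:R) + p%:R / th))%R ->
  (th <= spectral_radius R H)%R.
Proof.
move=> coreH t0 d0 th0 thE.
have H_gt0 : (0 < #|H|)%N.
  by case: coreH => _ [card0 _ _]; rewrite -card0 in t0; apply: leq_trans t0 (max_card _).
have [_] := spectral_radiusP R H_gt0; apply.
apply: (extremal_label_eigen (b := (t%:R / (th + 1 - m%:R))%R) (c := (t%:R / th)%R) coreH) => //.
- by rewrite {1}thE; ring.
- by field; rewrite gt_eqF.
- by field; rewrite gt_eqF.
Qed.

End Labels.

Section Join.
Variables (t m p : nat).

Definition star_label (x : join (complete t) (copies p (complete 1))) : 'I_3 :=
  if x is inl _ then inord 0 else inord 2.

Definition join_label
    (x : join (complete t) (union (complete m) (copies p (complete 1)))) : 'I_3 :=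
  match x with inl _ => inord 0 | inr (inl _) => inord 1 | inr (inr _) => inord 2 end.

Lemma card_label_sum (A B : finType) (P : pred (A + B)) :
  #|[set x | P x]| = (\sum_(a : A) P (inl a) + \sum_(b : B) P (inr b))%N.
Proof.
rewrite -sum1_card (eq_bigl P) => [|x]; last by rewrite inE.
by rewrite big_mkcond big_sumType; congr (_ + _)%N; apply: eq_bigr => x _; case: (P _).
Qed.

Lemma star_extremal : extremal_label t 0 p star_label.
Proof.
split.
  move=> [x|[x i]] [y|[y j]]; rewrite /label_rel /star_label !inordK //= /copies_adj /=.
  - by rewrite andbT (inj_eq (@inl_inj _ _)).
  - by rewrite !ord1 /complete_adj eqxx !andbF.
by split; rewrite card_label_sum /star_label !inordK //= !sum_nat_const
  ?card_prod ?card_ord ?muln0 ?muln1 ?addn0.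
Qed.

Lemma join_extremal : extremal_label t m p join_label.
Proof.
split.
  move=> [x|[x|[x i]]] [y|[y|[y j]]]; rewrite /label_rel /join_label !inordK //= /copies_adj /=.
  - by rewrite andbT (inj_eq (@inl_inj _ _)).
  - by rewrite andbT (inj_eq (@inr_inj _ _)) (inj_eq (@inl_inj _ _)).
  - by rewrite !ord1 /complete_adj eqxx !andbF.
by split; rewrite card_label_sum big_sumType /join_label !inordK //= !sum_nat_const
  ?card_prod ?card_ord ?muln0 ?muln1 ?addn0.
Qed.
End Join.

(** * The radius of a graph split into blocks *)

(** Outside S the vertices are divided into the q fibres of l, with no edge
between different fibres; m is the size of one fibre when all the others are
singletons. *)
Section Blocks.
Local Open Scope ring_scope.
Variables (R : realType) (G : sgraph) (S : {set G}) (l : G -> G) (m : nat) (th : R).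
Hypothesis adj_l : forall x y, x \notin S -> y \notin S -> adj x y -> l x = l y.

Let X := l @: ~: S.
Let t := #|S|.
Let q := #|X|.
Hypothesis cardS' : (#|~: S|.+1 = q + m)%N.
Hypothesis m_gt0 : (0 < m)%N.
Hypothesis th_gt : m%:R - 1 < th.
Hypothesis th_gt0 : 0 < th.
Hypothesis t_gt0 : (0 < t)%N.

Definition block x := [set z | (z \notin S) && (l z == x)].
Let n x := #|block x|.

(** The value of A y on a universal vertex of K_t v (K_m u (q-1) K_1), for the y
defined next. *)
Definition block_bound : R :=
  t%:R - 1 + t%:R * (m%:R / (th + 1 - m%:R) + (q%:R - 1) / th).

Let y x : R := if x \in S then 1 else t%:R / (th + 1 - (n (l x))%:R).

Lemma block_gt0 x : x \in X -> (0 < n x)%N.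
Proof.
case/imsetP=> z; rewrite in_setC => zS ->.
by apply/card_gt0P; exists z; rewrite inE zS eqxx.
Qed.

(** The excesses of the block sizes over 1 add up to m - 1; this one identity
gives both the bound m on a block and, in the tight case, that only one block
is large. *)
Lemma sum_block : (\sum_(x in X) (n x).-1 = m.-1)%N.
Proof.
have : (\sum_(x in X) n x = #|~: S|)%N.
  rewrite -[RHS]sum1_card [RHS](partition_big l (fun x => x \in X)) /=; last first.
    by move=> x xS; apply: imset_f.
  by apply: eq_bigr => x _; rewrite /n -sum1_card; apply: eq_bigl => z; rewrite !inE.
rewrite (eq_bigr (fun x => (n x).-1 + 1)%N); last first.
  by move=> x /block_gt0; rewrite addn1 => /prednK.
rewrite big_split /= sum1_card -/q; lia.
Qed.

Lemma block_le x : x \in X -> (n x <= m)%N.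
Proof.
move=> xX; have := sum_block; rewrite (bigD1 x) //=; have := block_gt0 xX; lia.
Qed.

Let in_X x : x \notin S -> l x \in X.
Proof. by move=> xS; apply: imset_f; rewrite in_setC. Qed.

Let den_gt0 x : x \in X -> 0 < th + 1 - (n x)%:R.
Proof. by move/block_le; rewrite -(ler_nat R) => ?; move: th_gt; lra. Qed.

Let y_gt0 x : 0 < y x.
Proof.
rewrite /y; case: ifPn => // /in_X xX.
by rewrite divr_gt0 ?ltr0n ?den_gt0.
Qed.

Lemma sum_adj_leif (f : G -> R) (P : pred G) x : (forall z, 0 < f z) ->
    (forall z, adj x z -> P z) ->
  \sum_(z | adj x z) f z <= \sum_(z | P z) f z ?= iff [forall (z | P z), adj x z].
Proof.
move=> f0 adjP.
have -> : \sum_(z | adj x z) f z = \sum_(z | P z) (if adj x z then f z else 0).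
  rewrite -big_mkcondr; apply: eq_bigl => z.
  by case: (boolP (adj x z)) => [/adjP->|]; rewrite ?andbF.
apply: leif_sum => z _; case: ifP => _; first exact/leif_refl.
by apply/leifP; rewrite f0.
Qed.

(** The choice of the value of y on a block makes the eigenvalue equation exact
when the block is complete and completely joined to S. *)
Let sum_in x : x \notin S ->
  \sum_(z | (z != x) && ((z \in S) || (l z == l x))) y z = th * y x.
Proof.
move=> xS; rewrite (bigID (mem S)) /=.
rewrite (eq_bigl (mem S)); last first.
  by move=> z /=; case: eqVneq => [->|_] /=; rewrite ?(negPf xS) //; case: (z \in S); rewrite ?andbF.
rewrite (eq_bigr (fun=> 1)); last by move=> z /= zS; rewrite /y zS.
rewrite sumr_const -/t (eq_bigl (mem (block (l x) :\ x))); last first.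
  by move=> z; rewrite !inE; case: (z \in S); rewrite ?andbF ?andbT.
rewrite (eq_bigr (fun=> y x)); last first.
  by move=> z; rewrite /y !inE (negPf xS) => /and3P[_ /negPf-> /eqP->].
rewrite sumr_const; have -> : #|block (l x) :\ x| = (n (l x)).-1.
  by rewrite /n [in RHS](cardsD1 x) inE xS eqxx.
have := den_gt0 (in_X xS); rewrite -[y x *+ _]mulr_natl /y (negPf xS).
rewrite -(prednK (block_gt0 (in_X xS))) /= -natr1 => d0.
by field; rewrite gt_eqF.
Qed.

(** Convexity of n / (th + 1 - n): on 1 <= n <= m it is below its chord, and
touches it at the endpoints only. The chord is written as value at 1 plus slope
times n - 1, so that it can be summed with [sum_block]. *)
Let term_leif x : x \in X ->
  (n x)%:R * (t%:R / (th + 1 - (n x)%:R)) <=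
   t%:R / th + (n x).-1%:R * (t%:R * (th + 1) / (th * (th + 1 - m%:R)))
   ?= iff ((n x == 1%N) || (n x == m)).
Proof.
move=> xX; have n0 := block_gt0 xX; have nm := block_le xX; have d0 := den_gt0 xX.
set a := (n x).-1; have na : n x = a.+1 by rewrite prednK.
have t0 : 0 < t%:R :> R by rewrite ltr0n.
have dm : 0 < th + 1 - m%:R by move: th_gt; lra.
rewrite na in d0 nm *; rewrite -natr1 in d0 *.
have nm' : 0 <= m%:R - a%:R - 1 :> R by move: nm; rewrite -(ler_nat R) -natr1; lra.
have gap : t%:R / th + a%:R * (t%:R * (th + 1) / (th * (th + 1 - m%:R))) -
  (a%:R + 1) * (t%:R / (th + 1 - (a%:R + 1))) =
  t%:R * (th + 1) / (th * (th + 1 - m%:R) * (th + 1 - (a%:R + 1)))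
    * (a%:R * (m%:R - a%:R - 1)).
  by field; rewrite !gt_eqF.
have c0 : 0 < t%:R * (th + 1) / (th * (th + 1 - m%:R) * (th + 1 - (a%:R + 1))).
  by rewrite divr_gt0 ?mulr_gt0 //; move: th_gt0 => ?; lra.
split; first by rewrite -subr_ge0 gap (mulr_ge0 (ltW c0)) // mulr_ge0 ?ler0n.
rewrite eq_sym -subr_eq0 gap mulf_eq0 (gt_eqF c0) /= mulf_eq0 pnatr_eq0 eqSS.
by congr (_ || _); rewrite -(eqr_nat R) -natr1 [RHS]eq_sym -[RHS]subr_eq0 opprD addrA.
Qed.

Let sum_out_leif :
  \sum_(z | z \notin S) y z <= t%:R * (m%:R / (th + 1 - m%:R) + (q%:R - 1) / th)
   ?= iff [forall (x | x \in X), (n x == 1%N) || (n x == m)].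
Proof.
have -> : \sum_(z | z \notin S) y z = \sum_(x in X) (n x)%:R * (t%:R / (th + 1 - (n x)%:R)).
  rewrite (partition_big l (fun x => x \in X)) /=; last exact: in_X.
  apply: eq_bigr => x _; rewrite (eq_bigl (mem (block x))); last by move=> z; rewrite !inE.
  rewrite (eq_bigr (fun=> t%:R / (th + 1 - (n x)%:R))).
    by rewrite sumr_const [RHS]mulr_natl.
  by move=> z; rewrite /= inE /y => /andP[/negPf-> /eqP->].
have -> : t%:R * (m%:R / (th + 1 - m%:R) + (q%:R - 1) / th) =
    \sum_(x in X) (t%:R / th + (n x).-1%:R * (t%:R * (th + 1) / (th * (th + 1 - m%:R)))).
  rewrite big_split /= sumr_const -/q -mulr_suml -natr_sum sum_block -mulr_natl.
  rewrite -(prednK m_gt0) -natr1 /=.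
  have d0 : 0 < th + 1 - (m.-1%:R + 1) by move: th_gt; rewrite -{1}(prednK m_gt0) -natr1; lra.
  by field; rewrite !gt_eqF.
exact: leif_sum term_leif.
Qed.

Let sum_S_leif x : x \in S ->
  \sum_(z | adj x z) y z <= block_bound
   ?= iff [forall (z | z != x), adj x z] && [forall (x | x \in X), (n x == 1%N) || (n x == m)].
Proof.
move=> xS; apply: leif_trans (_ : _ <= \sum_(z | z != x) y z ?= iff _) _.
  apply: sum_adj_leif => // z; apply: contraTneq => ->; by rewrite adj_irrefl.
rewrite (bigID (mem S)) /=.
have -> : \sum_(z | (z != x) && (z \in S)) y z = t%:R - 1.
  rewrite (eq_bigl (mem (S :\ x))) => [|z]; last by rewrite !inE.
  rewrite (eq_bigr (fun=> 1)) => [|z]; last by rewrite !inE /y => /andP[_ ->].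
  by rewrite sumr_const /t (cardsD1 x S) xS add1n -natr1 addrK.
rewrite (eq_bigl (fun z => z \notin S)) => [|z]; last first.
  by case: eqVneq => //= ->; rewrite xS.
have le1 : (t%:R - 1 : R) <= t%:R - 1 ?= iff true by apply/leif_refl.
exact: (leifD le1 sum_out_leif).
Qed.

(** If the radius reaches th, equality holds in all the estimates: at vertices
of S every adjacency is present and all block sizes are 1 or m, and every
block is complete. For m = 1 there is no large block, so
all the blocks get label 2. *)
Lemma block_radius : connected_graph G -> block_bound <= th -> th <= spectral_radius R G ->
  block_bound = th /\ exists L : G -> 'I_3,
    extremal_label t (if m == 1%N then 0 else m) (if m == 1%N then q else q.-1) L.
Proof.
move=> Gconn le_th th_le; have [Gsr _] := spectral_radiusP R (proj1 Gconn).
have Ay x : \sum_(z | adj x z) y z <= th * y x.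
  have [xS|xS] := boolP (x \in S).
    by rewrite [y x]/y xS mulr1; apply: le_trans le_th; apply: sum_S_leif.
  rewrite -sum_in //; apply: sum_adj_leif => // z xz.
  rewrite (contraTneq _ xz) => [|->]; last by rewrite adj_irrefl.
  by case: (boolP (z \in S)) => //= zS; rewrite (adj_l xS zS xz).
have [sr_le tight] := collatz_bound Gconn y_gt0 Ay Gsr.
have /tight {}tight : spectral_radius R G = th by apply/eqP; rewrite eq_le sr_le.
have [x0 x0S] : exists x, x \in S by apply/card_gt0P.
have th_eq : block_bound = th.
  apply/eqP; rewrite eq_le le_th -[th]mulr1; have -> : 1 = y x0 by rewrite /y x0S.
  by rewrite -tight; apply: sum_S_leif.
split => //.
have tightS x : x \in S -> (forall z, z != x -> adj x z) /\
    (forall x, x \in X -> (n x == 1%N) || (n x == m)).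
  move=> xS; have [_ /esym] := sum_S_leif xS.
  rewrite th_eq tight /y xS mulr1 eqxx => /andP[/forall_inP aS /forall_inP nS].
  by split.
have tightC x z : x \notin S -> z != x -> (z \in S) || (l z == l x) -> adj x z.
  move=> xS zx zl; have adjP w : adj x w -> (w != x) && ((w \in S) || (l w == l x)).
    move=> xw; rewrite (contraTneq _ xw) => [|->]; last by rewrite adj_irrefl.
    by case: (boolP (w \in S)) => //= wS; rewrite (adj_l xS wS xw).
  have [_ /esym] := sum_adj_leif y_gt0 adjP.
  by rewrite sum_in // tight eqxx => /forall_inP; apply; rewrite zx.
have [_ n1m] := tightS _ x0S.
pose L x : 'I_3 := if x \in S then inord 0 else if (n (l x) == 1)%N then inord 2 else inord 1.
have L0 x : (L x == 0%N :> nat) = (x \in S).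
  by rewrite /L; case: ifP => _; [|case: ifP => _]; rewrite inordK.
have L1 x : (L x == 1%N :> nat) = (x \notin S) && (n (l x) != 1%N).
  by rewrite /L; case: ifP => _; [|case: ifP => _]; rewrite inordK.
have L2 x : (L x == 2%N :> nat) = (x \notin S) && (n (l x) == 1%N).
  by rewrite /L; case: ifP => _; [|case: ifP => _]; rewrite inordK.
(* Two blocks of size m > 1 would have a total excess 2 (m - 1) > m - 1. *)
have uniq_big x z : x \in X -> z \in X -> n x != 1%N -> n z != 1%N -> x = z.
  move=> xX zX nx nz; apply/eqP; apply: contraT => xz.
  have := sum_block; rewrite (bigD1 x) //= (bigD1 z) /=; last by rewrite zX eq_sym.
  have := n1m _ xX; have := n1m _ zX; rewrite (negPf nx) (negPf nz) => /eqP-> /eqP nxm.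
  have := block_gt0 xX; lia.
have adjE x z : adj x z = (x != z) && label_rel (L x) (L z).
  have [<-|xz] := eqVneq x z; first by rewrite adj_irrefl.
  rewrite /label_rel !L0 !L1 /=.
  have [xS|xS] := boolP (x \in S).
    by have [-> //] := tightS _ xS; rewrite eq_sym.
  have [zS|zS] := boolP (z \in S).
    by rewrite adj_sym; have [-> //] := tightS _ zS.
  rewrite /=; apply/idP/andP => [xzA|[nx nz]].
    have lxz := adj_l xS zS xzA; rewrite -lxz; suff : (1 < n (l x))%N by case: (n _) => [|[]].
    have <- : #|[set x; z]| = 2%N by rewrite cards2 xz.
    apply: subset_leq_card; apply/subsetP => w; rewrite !inE => /orP[]/eqP->.
      by rewrite xS eqxx.
    by rewrite zS lxz eqxx.
  apply: tightC => //; first by rewrite eq_sym.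
  by rewrite (uniq_big _ _ (in_X xS) (in_X zS)) // eqxx orbT.
have card0 : #|[set x | L x == 0%N :> nat]| = t.
  by apply: eq_card => x; rewrite inE L0.
have card12 : (#|[set x | L x == 1%N :> nat]| + #|[set x | L x == 2%N :> nat]| = #|~: S|)%N.
  rewrite -(cardsID [set x | n (l x) != 1%N] (~: S)); congr (_ + _)%N.
    by apply: eq_card => x; rewrite !inE L1.
  by apply: eq_card => x; rewrite !inE L2 negbK andbC.
have card1 : #|[set x | L x == 1%N :> nat]| = (if m == 1%N then 0 else m)%N.
  case: (m =P 1%N) => m1.
    apply: eq_card0 => x; rewrite inE L1; apply/negbTE/negP => /andP[xS].
    by have := n1m _ (in_X xS); rewrite m1 orbb => ->.
  have [x [xS nx]] : exists x, x \notin S /\ n (l x) != 1%N.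
    have /existsP[x /andP[]] : [exists x, (x \notin S) && (n (l x) != 1%N)].
      apply: contraT; rewrite negb_exists => /forallP all1; case: m1.
      have := sum_block; rewrite big1 => [|z /imsetP[w]].
        by move: m_gt0; lia.
      by rewrite in_setC => wS ->; have := all1 w; rewrite wS /= negbK => /eqP->.
    by exists x.
  have nE : n (l x) = m by have := n1m _ (in_X xS); rewrite (negPf nx) => /eqP.
  rewrite -[RHS]nE; apply: eq_card => z; rewrite !inE L1.
  have [//|zS] := boolP (z \in S); apply/idP/eqP => [nz|->]; last by rewrite nx.
  exact: uniq_big (in_X zS) (in_X xS) nz nx.
exists L; split => //; split => //.
by move: card12; rewrite card1; case: eqP; lia.
Qed.

End Blocks.

(** * Comparing the candidate graphs *)

Section Algebra.
Local Open Scope ring_scope.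
Variable R : realType.
Implicit Types s t k th : R.

(** Up to positive factors, th minus the right-hand side of the equation that
determines the radius of K_t v (K_(2(s-t)+1) u (t+k-1) K_1); it is the
characteristic polynomial of the quotient matrix of that graph. *)
Definition quotient_poly s k t th : R :=
  th * (th + 1) * (th - 2 * s + t) - t * (t + k - 1) * (th - 2 * s + 2 * t).

Lemma quotient_polyE s k t th : 0 < th -> 0 < th - 2 * s + 2 * t ->
  th - (t - 1 + t * ((2 * s - 2 * t + 1) / (th + 1 - (2 * s - 2 * t + 1)) + (t + k - 1) / th))
  = quotient_poly s k t th / (th * (th - 2 * s + 2 * t)).
Proof.
move=> th0 d0; rewrite /quotient_poly.
have -> : th + 1 - (2 * s - 2 * t + 1) = th - 2 * s + 2 * t by ring.
by field; rewrite !gt_eqF.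
Qed.

(** For t = s the polynomial is th * (th^2 - (s-1) th - s(s+k)). The bound
2 s - 2 < th, where s <= k + 3 enters, is what the comparison with other t
uses. *)
Lemma star_root s k : 1 <= k -> 2 <= s -> s <= k + 3 ->
  exists2 th, 2 * s - 2 < th & quotient_poly s k s th = 0.
Proof.
move=> k1 s2 sk.
pose P : {poly R} := 'X ^+ 2 - (s - 1) *: 'X - (s * (s + k))%:P.
have PE x : P.[x] = x ^+ 2 - (s - 1) * x - s * (s + k) by rewrite /P !hornerE.
have [||th] := @poly_ivt _ P (2 * s - 2) (2 * s + k); first by lra.
  by rewrite ?in_itv /= !PE; apply/andP; split; nra.
rewrite /= rootE PE => /andP[th1 _] /eqP root_th.
exists th.
  rewrite lt_neqAle th1 andbT; apply/eqP => e; move: root_th; rewrite -e; nra.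
by rewrite -[RHS](mulr0 th) -root_th /quotient_poly; ring.
Qed.

(** At th = 2 s - 2 the factor th - 2 s + 2 vanishes, which leaves a negative
value, while at 2 s - 1 the polynomial is positive. *)
Lemma clique_root s k : 1 <= k -> k + 4 <= s ->
  exists2 th, 2 * s - 2 < th & quotient_poly s k 2 th = 0.
Proof.
move=> k1 ks.
pose P : {poly R} := 'X * ('X + 1%:P) * ('X - (2 * s - 2)%:P) - (2 * (k + 1)) *: ('X - (2 * s - 4)%:P).
have PE x : P.[x] = quotient_poly s k 2 x by rewrite /P !hornerE /quotient_poly; ring.
have [||th] := @poly_ivt _ P (2 * s - 2) (2 * s - 1); first by lra.
  by rewrite ?in_itv /= !PE /quotient_poly; apply/andP; split; nra.
rewrite /= rootE PE => /andP[th1 _] /eqP root_th.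
exists th => //; rewrite lt_neqAle th1 andbT; apply/eqP => e.
by move: root_th; rewrite -e /quotient_poly; nra.
Qed.

(** Put j = s - t. The relation for th makes the polynomial j times a quadratic in
j that is decreasing up to j = s - 2, where it equals
(k+1)(th+4) - s(s+k). *)
Lemma star_poly_gt0 s k t th : 1 <= k -> 2 <= t -> t + 1 <= s -> s <= k + 3 ->
  2 * s - 2 < th -> quotient_poly s k s th = 0 -> 0 < quotient_poly s k t th.
Proof.
move=> k1 t2 ts sk th_gt root_s.
have th0 : 0 < th by lra.
have rel : th ^+ 2 - (s - 1) * th - s * (s + k) = 0.
  apply: (mulfI (lt0r_neq0 th0)); rewrite mulr0 -root_s /quotient_poly; ring.
pose j := s - t.
have -> : quotient_poly s k t th =
    j * (2 * j ^+ 2 - j * (th + 4 * s + 2 * k - 2) + (s + k - 1) * th + s * (s + k - 2)).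
  by rewrite -[LHS]subr0 -[X in _ - X](mulr0 (th - j)) -rel /quotient_poly /j; ring.
apply: mulr_gt0; first by rewrite /j; lra.
(* Replacing th by 2 s - 2 leaves a concave function of s, nonnegative at s = 2
   and at s = k + 3. *)
have key : 0 < (k + 1) * (th + 4) - s * (s + k) by nra.
apply: lt_le_trans key _.
rewrite -subr_ge0.
have -> : 2 * j ^+ 2 - j * (th + 4 * s + 2 * k - 2) + (s + k - 1) * th + s * (s + k - 2)
  - ((k + 1) * (th + 4) - s * (s + k)) = (s - 2 - j) * (th + 2 * s + 2 * k + 2 - 2 * j).
  by ring.
by apply: mulr_ge0; rewrite /j; lra.
Qed.

(** Put j = t - 2. The relation for th makes the polynomial j times a cofactor
that decreases in j; at j = s - 2 it equals th (th - k - s) - 4 (k+1). *)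
Lemma clique_poly_gt0 s k t th : 1 <= k -> 3 <= t -> t <= s -> k + 4 <= s ->
  2 * s - 2 < th -> quotient_poly s k 2 th = 0 -> 0 < quotient_poly s k t th.
Proof.
move=> k1 t3 ts sk th_gt root_2.
pose j := t - 2.
have -> : quotient_poly s k t th = j * (th * (th + 1) - 4 * (k + 1) -
    (k + 3 + j) * (th - 2 * s + 4 + 2 * j)).
  by rewrite -[LHS]subr0 -root_2 /quotient_poly /j; ring.
apply: mulr_gt0; first by rewrite /j; lra.
(* With th > 2 s - 2 and s >= k + 4 the product exceeds 2 (2 k + 6). *)
have key : 0 < th * (th - k - s) - 4 * (k + 1) by nra.
apply: lt_le_trans key _; rewrite -subr_ge0.
have -> : th * (th + 1) - 4 * (k + 1) - (k + 3 + j) * (th - 2 * s + 4 + 2 * j) -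
  (th * (th - k - s) - 4 * (k + 1)) = (s - 2 - j) * (th + 2 * (k + 3 + j)).
  by ring.
by apply: mulr_ge0; rewrite /j; lra.
Qed.

End Algebra.

(** The common part of both cases: t0 is the extremal value of t, and th the
radius of the corresponding graph. *)
Lemma uncovered_extremal (R : realType) (G : sgraph) (s k t0 : nat) (th : R) :
    (1 <= k)%N -> connected_graph G -> #|G| = (2 * s + k)%N ->
    (matching_number G <= s)%N -> ~ maximum_matching_covered G ->
    (2 * s%:R - 2 < th)%R ->
    quotient_poly s%:R k%:R t0%:R th = 0%R ->
    (forall t, (2 <= t <= s)%N -> t != t0 -> 0 < quotient_poly s%:R k%:R t%:R th)%R ->
    (th <= spectral_radius R G)%R ->
  exists L : G -> 'I_3,
    if s == t0 then extremal_label t0 0 (t0 + k) L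
    else extremal_label t0 (2 * (s - t0) + 1) (t0 + k - 1) L.
Proof.
move=> k1 Gconn cG nuG ncov th_gt root0 pos th_le.
have [|S [X [t2 cX XS dX]]] := @uncovered_barrier G k _ ncov; first by lia.
have [|l l_adj cl] := disconnected_blocks _ XS dX; first by lia.
have cS : (#|S| + #|~: S| = #|G|)%N by rewrite cardsC.
have leX := subset_leq_card XS.
set t := #|S| in t2 cX cS; pose m := (2 * (s - t) + 1)%N.
have ts : (t <= s)%N by lia.
have tsR : (t%:R <= s%:R :> R)%R by rewrite ler_nat.
have t2R : (2 <= t%:R :> R)%R by rewrite ler_nat.
have mE : (m%:R = 2 * s%:R - 2 * t%:R + 1 :> R)%R by rewrite /m natrD natrM natrB //; ring.
have th0 : (0 < th)%R by lra.
have d0 : (0 < th - 2 * s%:R + 2 * t%:R)%R by lra.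
have bE : (th - block_bound S l m th =
    quotient_poly s%:R k%:R t%:R th / (th * (th - 2 * s%:R + 2 * t%:R)))%R.
  by rewrite -quotient_polyE // /block_bound cl cX mE natrD.
have poly_ge0 : (0 <= quotient_poly s%:R k%:R t%:R th)%R.
  by have [->|tt0] := eqVneq t t0; [rewrite root0 | rewrite ltW ?pos ?t2].
have [] := @block_radius R G S l m th l_adj _ _ _ th0 _ Gconn _ th_le.
- by rewrite cl cX /m; lia.
- by rewrite /m; lia.
- by rewrite mE; lra.
- by lia.
- by rewrite -subr_ge0 bE divr_ge0 // mulr_ge0 ?ltW.
rewrite -/t cl cX => bth [L coreL]; exists L.
have tE : t = t0.
  apply/eqP; apply: contraT => tt0.
  have /pos/(_ tt0) : (2 <= t <= s)%N by rewrite t2.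
  have : (quotient_poly s%:R k%:R t%:R th / (th * (th - 2 * s%:R + 2 * t%:R)) == 0)%R.
    by rewrite -bE bth subrr.
  by rewrite mulf_eq0 invr_eq0 mulf_eq0 !(gt_eqF th0, gt_eqF d0) !orbF => /eqP->; rewrite ltxx.
rewrite -tE -subn1 in coreL *; rewrite [m == 1%N](_ : _ = (s == t)) in coreL.
  by case: eqP coreL.
by rewrite /m; lia.
Qed.

Theorem theorem1p2 (R : realType) (k n : nat) (G : sgraph)
    (k_ge1 : (1 <= k)%N) (n_ge : (k + 4 <= n)%N) (n_mod : n = k %[mod 2])
    (G_conn : connected_graph G) (G_order : #|G| = n)
    (G_match : (matching_number G <= (n - k) %/ 2)%N) :
  let H1 := join (complete ((n - k) %/ 2)) (copies ((n + k) %/ 2) (complete 1)) in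
  let H2 := join (complete 2)
                 (union (complete (n - k - 3)) (copies (k + 1) (complete 1))) in
  ((n <= 3 * k + 6)%N ->
     (spectral_radius R H1 <= spectral_radius R G)%R ->
     ~ iso G H1 -> maximum_matching_covered G) /\
  ((3 * k + 8 <= n)%N ->
     (spectral_radius R H2 <= spectral_radius R G)%R ->
     ~ iso G H2 -> maximum_matching_covered G).
Proof.
move=> H1 H2.
pose s := ((n - k) %/ 2)%N; have nE : n = (2 * s + k)%N by rewrite /s; lia.
have s2 : (2 <= s)%N by lia.
have s2R : (2 <= s%:R :> R)%R by rewrite ler_nat.
have k1R : (1 <= k%:R :> R)%R by rewrite ler1n.
split=> n_le rho_le niso; apply: boolp.contrapT => ncov.
- have skR : (s%:R <= k%:R + 3 :> R)%R by rewrite -natrD ler_nat; lia.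
  have [th th_gt root_s] := star_root k1R s2R skR.
  have th0 : (0 < th)%R by lra.
  have H1E : H1 = join (complete s) (copies (s + k) (complete 1)).
    by rewrite /H1 (_ : (n + k) %/ 2 = s + k)%N //; lia.
  have H1core := star_extremal s (s + k).
  have th_le : (th <= spectral_radius R H1)%R.
    rewrite H1E; apply: (extremal_label_radius H1core _ _ th0); rewrite ?subr0; [lia|lra|].
    apply/eqP; rewrite -subr_eq0; apply/eqP.
    have <- : (quotient_poly s%:R k%:R s%:R th / (th * (th - 2 * s%:R + 2 * s%:R)) = 0)%R.
      by rewrite root_s mul0r.
    rewrite -quotient_polyE //; last by lra.
    by rewrite natrD; field; rewrite !gt_eqF //; lra.
  have [|t /andP[t2 ts] t_s|L] := uncovered_extremal (t0 := s) k_ge1 G_conn _ G_match ncov th_gt root_s _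
    (le_trans th_le rho_le); first by rewrite G_order.
    by apply: star_poly_gt0 => //; rewrite ?natr1 ler_nat; lia.
  by rewrite eqxx => Lcore; case: niso; rewrite H1E; apply: extremal_label_iso Lcore H1core.
- have skR : (k%:R + 4 <= s%:R :> R)%R by rewrite -natrD ler_nat; lia.
  have [th th_gt root_2] := clique_root k1R skR.
  have th0 : (0 < th)%R by lra.
  have H2core := join_extremal 2 (n - k - 3) (k + 1).
  have mE : ((n - k - 3)%:R = 2 * s%:R - 3 :> R)%R.
    by rewrite -[(2 * s%:R)%R]natrM -natrB; [congr (_%:R)%R; lia | lia].
  have th_le : (th <= spectral_radius R H2)%R.
    apply: (extremal_label_radius H2core _ _ th0) => //; first by rewrite mE; lra.
    apply/eqP; rewrite -subr_eq0; apply/eqP.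
    have <- : (quotient_poly s%:R k%:R 2 th / (th * (th - 2 * s%:R + 2 * 2)) = 0)%R.
      by rewrite root_2 mul0r.
    rewrite -quotient_polyE //; last by lra.
    by rewrite mE natrD; field; rewrite !gt_eqF //; lra.
  have [|t /andP[t2 ts] t_2|L] := uncovered_extremal (t0 := 2) k_ge1 G_conn _ G_match ncov th_gt root_2 _
    (le_trans th_le rho_le); first by rewrite G_order.
    apply: clique_poly_gt0 => //; rewrite ler_nat; lia.
  have -> : (s == 2%N) = false by lia.
  have -> : (2 * (s - 2) + 1 = n - k - 3)%N by lia.
  have -> : (2 + k - 1 = k + 1)%N by lia.
  by move=> Lcore; case: niso; apply: extremal_label_iso Lcore H2core.
Qed.
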